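(* Let $\alpha\in\mathbb{R}$ be the only real root of an irreducible cubic polynomial in $\mathbb{Q}[x]$. Then there exists a Peck sequence for the pair $(\alpha,\alpha^2)$.
   Context: For $x\in\mathbb{R}$, $\|x\|$ denotes the distance from $x$ to the nearest integer. A Peck sequence for a pair $(\sigma,\tau)$ of real numbers is a strictly increasing sequence $(s_n)_{n\ge1}$ of positive integers for which there exist constants $M_1,M_2>0$ and an infinite subsequence $(\psi_n)_{n\ge1}$ of $(s_n)$ with all $\psi_n\ge 2$, such that for all $n$: $\max\{\|s_n\sigma\|,\|s_n\tau\|\}<\frac{M_1}{s_n^{1/2}}$ and $\|\psi_n\sigma\|<\frac{M_2}{\psi_n^{1/2}\log\psi_n}$. *)

(* Defs.v *)
From HB Require Import structures.
From mathcomp Require Import all_boot all_order all_algebra.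
From Stdlib Require Import Reals.

Set Implicit Arguments.
Unset Strict Implicit.
Unset Printing Implicit Defensive.

Definition int_to_R (z : int) : R :=
  match z with
  | Posz n => INR n
  | Negz n => (- INR (S n))%R
  end.

Definition rat_to_R (q : rat) : R :=
  (int_to_R (numq q) / int_to_R (denq q))%R.

Definition peval_R (p : {poly rat}) (x : R) : R :=
  foldr (fun c acc => (rat_to_R c + x * acc)%R) 0%R (polyseq p).

Definition dist_nint (x : R) : R :=
  let f := (x - IZR (Int_part x))%R in Rmin f (1 - f)%R.

Definition Peck_sequence (sigma tau : R) (s : nat -> nat) : Prop :=
  (forall n, (0 < s n)%nat) /\
  (forall n, (s n < s (S n))%nat) /\
  exists (M1 M2 : R), (0 < M1)%R /\ (0 < M2)%R /\
  exists phi : nat -> nat,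
    (forall n, (phi n < phi (S n))%nat) /\
    (forall n, (2 <= s (phi n))%nat) /\
    (forall n,
      (Rmax (dist_nint (INR (s n) * sigma)) (dist_nint (INR (s n) * tau))
         < M1 / sqrt (INR (s n)))%R) /\
    (forall n,
      (dist_nint (INR (s (phi n)) * sigma)
         < M2 / (sqrt (INR (s (phi n))) * ln (INR (s (phi n)))))%R).

(* Main.v *)
Require Import Defs.
From Stdlib Require Import ZArith Lra Lia Psatz Classical ClassicalEpsilon.
From mathcomp Require Import zify.
From HB Require Import structures.
From mathcomp Require Import all_boot all_order all_algebra.
From mathcomp Require Import Rstruct.
From Stdlib Require Import Reals.

(** Clearing denominators, [beta = a alpha] is an algebraic integer with complex conjugates
    [r +- i w].  By the pigeonhole principle [Z[beta]] contains elements of bounded norm with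
    arbitrarily small real embedding; two of them with the same norm that are congruent modulo
    it have as quotient a unit [e > 1], and the complex embedding [z] of [e] has modulus
    [e^(-1/2)].  Write [e^n = a_n + b_n beta + c_n beta^2].  Then [c_n] is asymptotic to a
    constant times [e^n], both [c_n beta] and [c_n beta^2] are within [O(e^(-n/2))] of integers,
    and, because [c_n] is the trace of [e^n / f'(beta)], with [f] the minimal polynomial of
    [beta], the error for [c_n beta] is exactly [Im (z^n) / w].  Dirichlet's theorem applied to
    [arg z / PI] yields infinitely many [n] with [|Im (z^n)| <= PI e^(-n/2) / n], and
    [n] is of the order of [ln c_n].  The denominators [a^2 c_n] for these [n] already satisfy
    the stronger bound, so the subsequence is the whole sequence. *)

Delimit Scope nat_scope with N.
Local Open Scope R_scope.

(** * Pigeonhole and Diophantine approximation *)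

Lemma Int_part_bounds (x : R) : IZR (Int_part x) <= x < IZR (Int_part x) + 1.
Proof. have [h1 h2] := base_Int_part x; lra. Qed.

Lemma dist_nint_le (x : R) (m : Z) : dist_nint x <= Rabs (x - IZR m).
Proof.
rewrite /dist_nint; have [h1 h2] := Int_part_bounds x.
have [hm|hm] := Z_le_gt_dec m (Int_part x).
- apply: Rle_trans (Rmin_l _ _) _; rewrite Rabs_pos_eq; have := IZR_le _ _ hm; lra.
- apply: Rle_trans (Rmin_r _ _) _; rewrite Rabs_left1;
    have : IZR (Int_part x + 1) <= IZR m by [apply: IZR_le; lia]; rewrite plus_IZR; lra.
Qed.

(** Cut [0, 1) into [K] half-open intervals of length [1 / K]; with more than [K] points, two share
    an interval. *)
Lemma unit_interval_pigeonhole (T : finType) (f : T -> R) (K : nat) :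
  (0 < K)%N -> (K < #|T|)%N -> (forall x, 0 <= f x < 1) ->
  exists x y : T, x != y /\ Rabs (f x - f y) < / INR K.
Proof.
case: K => // K _ hK hf.
have K0 : 0 < INR K.+1 by apply: lt_0_INR; lia.
pose box x := Int_part (INR K.+1 * f x).
have hbox x : (0 <= box x < Z.of_nat K.+1)%Z.
  have [b1 b2] := Int_part_bounds (INR K.+1 * f x); have [f1 f2] := hf x.
  split.
  - suff : (-1 < box x)%Z by lia.
    by apply: lt_IZR; rewrite /box; nra.
  - by apply: lt_IZR; rewrite /box -INR_IZR_INZ; nra.
pose g x : 'I_K.+1 := inord (Z.to_nat (box x)).
have /injectivePn [x [y xy /(congr1 val)]] : ~~ injectiveb g.
  by apply/negP => /injectiveP /leq_card; rewrite card_ord; lia.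
rewrite /g /= !inordK; [|have := hbox y; lia|have := hbox x; lia] => hxy.
have {}hxy : box x = box y by have := hbox x; have := hbox y; lia.
exists x, y; split=> //.
have [a1 a2] := Int_part_bounds (INR K.+1 * f x).
have [b1 b2] := Int_part_bounds (INR K.+1 * f y).
rewrite -/(box x) -/(box y) hxy in a1 a2 b1 b2.
apply: (Rmult_lt_reg_l (INR K.+1)) => //; rewrite Rinv_r; last lra.
rewrite -{1}(Rabs_pos_eq (INR K.+1)); last lra.
by rewrite -Rabs_mult; apply: Rabs_def1; lra.
Qed.

(** Pigeonhole on the fractional parts of [i rho] for [0 <= i <= N]; the difference of two indices
    is the multiplier. *)
Lemma dirichlet_approximation (rho : R) (N : nat) : (0 < N)%N ->
  exists (n : nat) (m : Z), [/\ (0 < n)%N, (n <= N)%N & Rabs (INR n * rho - IZR m) < / INR N].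
Proof.
move=> N0.
pose fl (i : 'I_N.+1) := Int_part (INR i * rho).
have [||i [j [ij hij]]] :=
  @unit_interval_pigeonhole _ (fun i : 'I_N.+1 => INR i * rho - IZR (fl i)) N N0.
- by rewrite card_ord.
- by move=> i; have := Int_part_bounds (INR i * rho); rewrite /fl; lra.
wlog ltij : i j ij hij / (j < i)%N.
  move=> H; have [/H|] := ltnP j i; first exact.
  rewrite leq_eqVlt => /orP [/eqP /val_inj e|]; first by rewrite e eqxx in ij.
  by apply: H; rewrite 1?eq_sym // Rabs_minus_sym.
exists (i - j)%N, (fl i - fl j)%Z; split; [lia|by have := ltn_ord i; lia|].
rewrite minus_INR; last lia.
by rewrite minus_IZR; move: hij; congr (Rabs _ < _); ring.
Qed.

(** For rational [rho], multiples of a denominator give error 0. For irrational [rho], the positive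
    [n < B] keep [n rho] at distance at least some [d > 0] from the integers, so Dirichlet's theorem
    with [1 / N < d] can only return [n >= B]. *)
Lemma dirichlet_approximation_infinite (rho : R) (B : nat) :
  exists (n : nat) (m : Z), [/\ (0 < n)%N, (B <= n)%N & Rabs (INR n * rho - IZR m) <= / INR n].
Proof.
have [[n [m [n0 e]]]|irr] :=
  classic (exists (n : nat) (m : Z), (0 < n)%N /\ INR n * rho = IZR m).
- exists (n * B.+1)%N, (m * Z.of_nat B.+1)%Z; split; [lia|nia|].
  rewrite mult_IZR -INR_IZR_INZ mult_INR -e.
  rewrite (_ : _ - _ = 0) ?Rabs_R0; last ring.
  by apply: Rlt_le; apply: Rinv_0_lt_compat; apply: Rmult_lt_0_compat; apply: lt_0_INR; lia.
have [d [d0 hd]] : exists d, 0 < d /\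
    forall (n : nat) (m : Z), (0 < n)%N -> (n < B)%N -> d <= Rabs (INR n * rho - IZR m).
  elim: B => [|B [d [d0 hd]]]; first by exists 1; split=> //; lra.
  have [->|B0] := posnP B; first by exists 1; split; [lra|lia].
  pose d' := dist_nint (INR B * rho).
  have d'0 : 0 < d'.
    rewrite /d' /dist_nint; have [h1 h2] := Int_part_bounds (INR B * rho).
    apply: Rmin_glb_lt; last lra.
    have : INR B * rho <> IZR (Int_part (INR B * rho)).
      by move=> e; apply: irr; exists B, (Int_part (INR B * rho)).
    lra.
  exists (Rmin d d'); split; first exact: Rmin_glb_lt.
  move=> n m n0; rewrite ltnS leq_eqVlt => /orP [/eqP ->|nB].
  - apply: Rle_trans (Rmin_r _ _) _; exact: dist_nint_le.
  - apply: Rle_trans (Rmin_l _ _) _; exact: hd.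
have [N [hN N0]] := archimed_cor1 d d0.
have [|n [m [n0 nN hn]]] := @dirichlet_approximation rho N; first lia.
exists n, m; split=> //.
- rewrite leqNgt; apply/negP => nB; have := hd n m n0 nB; lra.
- apply: Rle_trans (Rlt_le _ _ hn) _; apply: Rinv_le_contravar; first by apply: lt_0_INR; lia.
  by apply: le_INR; lia.
Qed.

Lemma Rabs_sin_le (x : R) : Rabs (sin x) <= Rabs x.
Proof.
have H y : 0 < y -> sin y < y by exact: sin_lt_x.
have H' y : 0 < y -> - y < sin y.
  move=> y0; have [h|h] := Rle_lt_dec y PI.
  - by have := sin_ge_0 y (Rlt_le _ _ y0) h; lra.
  - by have := SIN_bound y; have := PI2_1; lra.
have [h|[->|h]] := Rtotal_order x 0.
- have := H (- x); have := H' (- x); rewrite sin_neg (Rabs_left x) // => a b.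
  by apply: Rabs_le; lra.
- by rewrite sin_0; lra.
- by rewrite (Rabs_pos_eq x); [apply: Rabs_le; have := H x; have := H' x; lra|lra].
Qed.

Lemma sin_add_IZR_PI (x : R) (m : Z) : Rabs (sin (x + IZR m * PI)) = Rabs (sin x).
Proof.
have Hn y (n : nat) : Rabs (sin (y + INR n * PI)) = Rabs (sin y).
  elim: n => [|n IH]; first by rewrite /= Rmult_0_l Rplus_0_r.
  rewrite S_INR (_ : y + _ = (y + INR n * PI) + PI); last ring.
  by rewrite neg_sin Rabs_Ropp.
case: (Z_le_gt_dec 0 m) => hm.
- by rewrite -(Z2Nat.id m) // -INR_IZR_INZ.
- rewrite -(Hn _ (Z.to_nat (- m))) INR_IZR_INZ Z2Nat.id; last lia.
  by rewrite opp_IZR; congr (Rabs (sin _)); ring.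
Qed.

(** Shifting the argument by a multiple of [PI] only changes the sign of the sine, so it suffices
    that [n theta / PI] is close to an integer. *)
Lemma small_sin_infinite (theta : R) (B : nat) :
  exists n : nat, [/\ (0 < n)%N, (B <= n)%N & Rabs (sin (INR n * theta)) <= PI / INR n].
Proof.
have P0 := PI_RGT_0.
have [n [m [n0 nB hn]]] := dirichlet_approximation_infinite (theta / PI) B.
exists n; split=> //.
rewrite -(sin_add_IZR_PI _ (- m)); apply: Rle_trans (Rabs_sin_le _) _.
rewrite (_ : _ + _ = PI * (INR n * (theta / PI) - IZR m)); last by rewrite opp_IZR; field; lra.
rewrite Rabs_mult (Rabs_pos_eq PI); last lra.
by apply: Rmult_le_compat_l; lra.
Qed.

(** Pigeonhole on the fractional parts of the [(N + 1)^2] values [i b + j g], with [N^2]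
    intervals. *)
Lemma linear_form_approximation (b g : R) (N : nat) : (0 < N)%N ->
  exists x y z : Z, [/\ y <> 0%Z \/ z <> 0%Z, Rabs (IZR y) <= INR N, Rabs (IZR z) <= INR N &
    Rabs (IZR x + IZR y * b + IZR z * g) < / (INR N * INR N)].
Proof.
move=> N0.
pose F (i : 'I_N.+1 * 'I_N.+1) := INR i.1 * b + INR i.2 * g.
have [|||i [j [ij hij]]] :=
  @unit_interval_pigeonhole _ (fun i : 'I_N.+1 * 'I_N.+1 => F i - IZR (Int_part (F i))) (N * N)%N.
- nia.
- by rewrite card_prod !card_ord; nia.
- by move=> i; have := Int_part_bounds (F i); lra.
move: hij; move: (Int_part (F i)) (Int_part (F j)) => p q hij.
exists (q - p)%Z, (Z.of_nat i.1 - Z.of_nat j.1)%Z,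
  (Z.of_nat i.2 - Z.of_nat j.2)%Z.
have bnd (k l : 'I_N.+1) : Rabs (IZR (Z.of_nat k - Z.of_nat l)) <= INR N.
  have := ltn_ord k; have := ltn_ord l => hl hk.
  rewrite INR_IZR_INZ -abs_IZR; apply: IZR_le; lia.
split=> //.
- move: ij; case: i {hij} => i1 i2; case: j => j1 j2 /= ij.
  apply: NNPP => H; case/negP: ij; apply/eqP.
  by congr (_, _); apply: val_inj => /=; lia.
- rewrite -mult_INR !minus_IZR -!INR_IZR_INZ; move: hij; congr (Rabs _ < _).
  by rewrite /F; case: i {ij} => i1 i2; case: j => j1 j2 /=; ring.
Qed.

Lemma strictly_increasing_choice (P : nat -> Prop) :
  (forall B : nat, exists n : nat, (B <= n)%N /\ P n) ->
  exists f : nat -> nat, (forall n, (f n < f n.+1)%N) /\ forall n, P (f n).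
Proof.
move=> H.
pose g B := proj1_sig (constructive_indefinite_description _ (H B)).
have hg B : (B <= g B)%N /\ P (g B) := proj2_sig (constructive_indefinite_description _ (H B)).
pose f := fix f n := if n is k.+1 then g (f k).+1 else g 0%N.
exists f; split=> [n|[|n]] /=; [exact: (hg _).1|exact: (hg _).2|exact: (hg _).2].
Qed.

(** * Arithmetic of Z[beta] in the coordinates on 1, beta, beta^2 *)

Record cubic_elt := CubicElt { co0 : Z; co1 : Z; co2 : Z }.

(** [p3] and [p4] are the coefficients of beta^3 and beta^4, reduced by beta^3 = t beta^2 + u beta +
    v and beta^4 = (t^2 + u) beta^2 + (t u + v) beta + t v. *)
Definition cubic_mul (t u v : Z) (x y : cubic_elt) : cubic_elt :=
  let: CubicElt a b c := x in let: CubicElt a' b' c' := y in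
  let p3 := (b * c' + c * b')%Z in let p4 := (c * c')%Z in
  CubicElt (a * a' + v * p3 + t * v * p4)
           (a * b' + b * a' + u * p3 + (t * u + v) * p4)
           (a * c' + b * b' + c * a' + t * p3 + (t * t + u) * p4).

(* First column of the adjugate of the matrix of multiplication by [x]. *)
Definition cubic_adj (t u v : Z) (x : cubic_elt) : cubic_elt :=
  let: CubicElt a b c := x in
  let d := (b + c * t)%Z in let f := (a + c * u)%Z in
  CubicElt (f * (f + t * d) - (c * v + u * d) * d)
           (- (b * (f + t * d) - (c * v + u * d) * c))
           (b * d - f * c).

(** The determinant of multiplication by [x], expanded along the first row of its matrix. *)
Definition cubic_norm (t u v : Z) (x : cubic_elt) : Z :=
  let: CubicElt a b c := x in let: CubicElt y0 y1 y2 := cubic_adj t u v x in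
  (a * y0 + c * v * y1 + v * (b + c * t) * y2)%Z.

Definition real_emb (beta : R) (x : cubic_elt) : R :=
  IZR (co0 x) + IZR (co1 x) * beta + IZR (co2 x) * (beta * beta).
Definition cplx_emb_re (r w : R) (x : cubic_elt) : R :=
  IZR (co0 x) + IZR (co1 x) * r + IZR (co2 x) * (r * r - w * w).
Definition cplx_emb_im (r w : R) (x : cubic_elt) : R :=
  IZR (co1 x) * w + IZR (co2 x) * (2 * r * w).

(* [x^3 - t x^2 - u x - v] has the roots [beta], [r + i w] and [r - i w]. *)
Definition cubic_roots (t u v : Z) (beta r w : R) : Prop :=
  [/\ IZR t = beta + 2 * r, IZR u = - (2 * r * beta + r * r + w * w)
    & IZR v = beta * (r * r + w * w)].

Lemma cubic_mul_adj (t u v : Z) (x : cubic_elt) :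
  cubic_mul t u v x (cubic_adj t u v x) = CubicElt (cubic_norm t u v x) 0 0.
Proof. by case: x => a b c; rewrite /cubic_mul /=; congr CubicElt; ring. Qed.

Lemma real_emb_mul (t u v : Z) (beta r w : R) (x y : cubic_elt) :
  cubic_roots t u v beta r w ->
  real_emb beta (cubic_mul t u v x y) = real_emb beta x * real_emb beta y.
Proof.
case: x y => a b c [a' b' c'] [ht hu hv]; rewrite /real_emb /=.
by rewrite !(plus_IZR, mult_IZR) ht hu hv; ring.
Qed.

Lemma cplx_emb_re_mul (t u v : Z) (beta r w : R) (x y : cubic_elt) :
  cubic_roots t u v beta r w ->
  cplx_emb_re r w (cubic_mul t u v x y) =
    cplx_emb_re r w x * cplx_emb_re r w y - cplx_emb_im r w x * cplx_emb_im r w y.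
Proof.
case: x y => a b c [a' b' c'] [ht hu hv]; rewrite /cplx_emb_re /cplx_emb_im /=.
by rewrite !(plus_IZR, mult_IZR) ht hu hv; ring.
Qed.

Lemma cplx_emb_im_mul (t u v : Z) (beta r w : R) (x y : cubic_elt) :
  cubic_roots t u v beta r w ->
  cplx_emb_im r w (cubic_mul t u v x y) =
    cplx_emb_re r w x * cplx_emb_im r w y + cplx_emb_im r w x * cplx_emb_re r w y.
Proof.
case: x y => a b c [a' b' c'] [ht hu hv]; rewrite /cplx_emb_re /cplx_emb_im /=.
by rewrite !(plus_IZR, mult_IZR) ht hu hv; ring.
Qed.

Lemma IZR_cubic_norm (t u v : Z) (beta r w : R) (x : cubic_elt) :
  cubic_roots t u v beta r w ->
  IZR (cubic_norm t u v x) =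
    real_emb beta x *
    (cplx_emb_re r w x * cplx_emb_re r w x + cplx_emb_im r w x * cplx_emb_im r w x).
Proof.
case: x => a b c [ht hu hv]; rewrite /real_emb /cplx_emb_re /cplx_emb_im /=.
by rewrite !(plus_IZR, mult_IZR, opp_IZR, minus_IZR) ht hu hv; ring.
Qed.

Lemma cubic_norm_mul (t u v : Z) (beta r w : R) (x y : cubic_elt) :
  cubic_roots t u v beta r w ->
  cubic_norm t u v (cubic_mul t u v x y) = (cubic_norm t u v x * cubic_norm t u v y)%Z.
Proof.
move=> h; apply: eq_IZR; rewrite mult_IZR !(IZR_cubic_norm _ _ _ _ _ _ _ h).
rewrite (real_emb_mul _ _ _ _ _ _ _ _ h) (cplx_emb_re_mul _ _ _ _ _ _ _ _ h) (cplx_emb_im_mul _ _ _ _ _ _ _ _ h).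
by ring.
Qed.

(** * Elements of small real embedding and a unit of infinite order *)

Definition Zfree_powers (beta : R) : Prop :=
  forall a b c : Z, IZR a + IZR b * beta + IZR c * (beta * beta) = 0 ->
  [/\ a = 0%Z, b = 0%Z & c = 0%Z].

(** The linear form lemma makes the real embedding smaller than [1 / N^2] with coefficients O(N).
    The complex embedding is then O(N), and the norm, being the real embedding times the squared
    modulus of the complex one, stays bounded. *)
Lemma small_elements_bounded_norm (t u v : Z) (beta r w : R) :
  cubic_roots t u v beta r w -> Zfree_powers beta ->
  exists C : nat, forall d : R, 0 < d -> exists x : cubic_elt,
    0 < Rabs (real_emb beta x) < d /\ (Z.abs (cubic_norm t u v x) <= Z.of_nat C)%Z.
Proof.
move=> hr hfree.
pose A := 1 + Rabs beta + Rabs (beta * beta) + Rabs r + Rabs (r * r - w * w).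
pose B := Rabs w + Rabs (2 * r * w).
have [C hC] := INR_unbounded (A * A + B * B).
exists C => d d0.
have [N [hN N0]] := archimed_cor1 d d0.
have [|a [b [c [nz hb hc hs]]]] := linear_form_approximation beta (beta * beta) N; first lia.
have N1 : 1 <= INR N by apply: (le_INR 1); lia.
exists (CubicElt a b c).
pose s := real_emb beta (CubicElt a b c).
have hs' : Rabs s < / (INR N * INR N) by [].
have iN : / (INR N * INR N) <= / INR N by apply: Rinv_le_contravar; nra.
have iN1 : / INR N <= 1 by rewrite -Rinv_1; apply: Rinv_le_contravar; lra.
split.
  split; last by rewrite -/s; lra.
  by apply: Rabs_pos_lt => /hfree [_ b0 c0]; case: nz.
have Mle (z : Z) (x : R) : Rabs (IZR z) <= INR N -> Rabs (IZR z * x) <= INR N * Rabs x.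
  by move=> hz; rewrite Rabs_mult; apply: Rmult_le_compat_r => //; exact: Rabs_pos.
(* The linear form lemma bounds only [b] and [c]; [a] is recovered from the small value [s]. *)
have ha : Rabs (IZR a) <= INR N * (1 + Rabs beta + Rabs (beta * beta)).
  have -> : IZR a = s - IZR b * beta - IZR c * (beta * beta) by rewrite /s /real_emb /=; ring.
  have h1 := Mle b beta hb; have h2 := Mle c (beta * beta) hc.
  have h3 := Rabs_triang (s - IZR b * beta) (- (IZR c * (beta * beta))).
  have h4 := Rabs_triang s (- (IZR b * beta)).
  rewrite !Rabs_Ropp in h3 h4; rewrite /Rminus in h3 *; lra.
have hre : Rabs (cplx_emb_re r w (CubicElt a b c)) <= INR N * A.
  rewrite /cplx_emb_re /= /A.
  have h1 := Mle b r hb; have h2 := Mle c (r * r - w * w) hc.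
  have h3 := Rabs_triang (IZR a + IZR b * r) (IZR c * (r * r - w * w)).
  have h4 := Rabs_triang (IZR a) (IZR b * r); lra.
have him : Rabs (cplx_emb_im r w (CubicElt a b c)) <= INR N * B.
  rewrite /cplx_emb_im /= /B.
  have h1 := Mle b w hb; have h2 := Mle c (2 * r * w) hc.
  have h3 := Rabs_triang (IZR b * w) (IZR c * (2 * r * w)); lra.
apply: le_IZR; rewrite abs_IZR (IZR_cubic_norm _ _ _ _ _ _ _ hr) -INR_IZR_INZ -/s Rabs_mult.
move: hre him; set x := cplx_emb_re _ _ _; set y := cplx_emb_im _ _ _ => hx hy.
have sq z M : Rabs z <= M -> z * z <= M * M.
  by move=> hz; rewrite -[z * z]Rabs_pos_eq ?Rabs_mult; [have := Rabs_pos z; nra|nra].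
have {hx}hx := sq _ _ hx; have {hy}hy := sq _ _ hy.
rewrite (Rabs_pos_eq (x * x + y * y)); last nra.
apply: Rle_trans (Rlt_le _ _ hC).
apply: (Rle_trans _ (/ (INR N * INR N) * (INR N * INR N * (A * A + B * B)))); last first.
  by apply: Req_le; field; lra.
apply: Rmult_le_compat; [exact: Rabs_pos|nra|lra|lra].
Qed.

Lemma real_emb_inj (beta : R) (x y : cubic_elt) :
  Zfree_powers beta -> real_emb beta x = real_emb beta y -> x = y.
Proof.
case: x y => a b c [a' b' c'] hfree; rewrite /real_emb /= => e.
have [|h0 h1 h2] := hfree (a - a')%Z (b - b')%Z (c - c')%Z; first by rewrite !minus_IZR; lra.
by congr CubicElt; lia.
Qed.

(** If the complex embedding vanished, its imaginary part would give [b + 2 r c = 0]. Since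
    [2 r = t - beta], this is an integral relation between 1 and beta, which forces [c = 0], then
    [b = 0] and [a = 0]. *)
Lemma cubic_norm_neq0 (t u v : Z) (beta r w : R) (x : cubic_elt) :
  cubic_roots t u v beta r w -> w <> 0 -> Zfree_powers beta ->
  real_emb beta x <> 0 -> cubic_norm t u v x <> 0%Z.
Proof.
move=> hr w0 hfree s0 /(congr1 IZR); rewrite (IZR_cubic_norm _ _ _ _ _ _ _ hr).
case/Rmult_integral => // h.
have re0 : cplx_emb_re r w x = 0 by nra.
have im0 : cplx_emb_im r w x = 0 by nra.
case: hr => ht _ _; case: x s0 re0 im0 {h} => a b c; rewrite /real_emb /cplx_emb_re /cplx_emb_im /=.
move=> s0 re0 im0.
have {}im0 : IZR b + 2 * r * IZR c = 0 by apply: (Rmult_eq_reg_r w) => //; lra.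
have [|_ c0 _] := hfree (- b - c * t)%Z c 0%Z.
  by rewrite minus_IZR opp_IZR mult_IZR ht; lra.
rewrite c0 in s0 re0 im0; apply: s0; rewrite (_ : IZR b = 0) in re0 *; lra.
Qed.

(* If [x = y + n q] with [n] the norm of [y], then [x / y = 1 + q (n / y)] and [n / y = adj y]. *)
Lemma congruent_quotient_integral (t u v : Z) (beta r w : R) (x y : cubic_elt) :
  cubic_roots t u v beta r w -> w <> 0 -> Zfree_powers beta -> real_emb beta y <> 0 ->
  let n := cubic_norm t u v y in
  (n | co0 x - co0 y)%Z -> (n | co1 x - co1 y)%Z -> (n | co2 x - co2 y)%Z ->
  exists e : cubic_elt, cubic_mul t u v e y = x.
Proof.
move=> hr w0 hfree s0 n [q0 h0] [q1 h1] [q2 h2].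
pose q := CubicElt q0 q1 q2; pose m := cubic_mul t u v q (cubic_adj t u v y).
exists (CubicElt (1 + co0 m) (co1 m) (co2 m)).
apply: (real_emb_inj _ _ _ hfree); rewrite (real_emb_mul _ _ _ _ _ _ _ _ hr).
have hm : real_emb beta m = real_emb beta q * real_emb beta (cubic_adj t u v y).
  exact: (real_emb_mul _ _ _ _ _ _ _ _ hr).
have hn : real_emb beta y * real_emb beta (cubic_adj t u v y) = IZR n.
  by rewrite -(real_emb_mul _ _ _ _ _ _ _ _ hr) cubic_mul_adj /n;
    move: (cubic_norm _ _ _ _) => z; rewrite /real_emb /=; ring.
have -> : real_emb beta (CubicElt (1 + co0 m) (co1 m) (co2 m)) = 1 + real_emb beta m.
  by rewrite /real_emb; cbn [co0 co1 co2]; rewrite plus_IZR; ring.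
have hx : real_emb beta x = real_emb beta y + real_emb beta q * IZR n.
  rewrite /real_emb /= (_ : co0 x = co0 y + q0 * n)%Z; last lia.
  rewrite (_ : co1 x = co1 y + q1 * n)%Z; last lia.
  rewrite (_ : co2 x = co2 y + q2 * n)%Z; last lia.
  by rewrite !plus_IZR !mult_IZR; ring.
by rewrite hx hm -hn; ring.
Qed.

Lemma exists_nontrivial_unit (t u v : Z) (beta r w : R) :
  cubic_roots t u v beta r w -> w <> 0 -> Zfree_powers beta ->
  exists e : cubic_elt, cubic_norm t u v e = 1%Z /\ 1 < real_emb beta e.
Proof.
move=> hr w0 hfree.
have [C hC] := small_elements_bounded_norm t u v beta r w hr hfree.
pose sg := real_emb beta; pose nm := cubic_norm t u v.
have [X hX] : exists X : nat -> cubic_elt, forall k,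
    [/\ sg (X k) <> 0, Rabs (sg (X k.+1)) < Rabs (sg (X k))
      & (Z.abs (nm (X k)) <= Z.of_nat C)%Z].
  (* With [0 < d] inside the existential, choice yields a function [G] on all reals. Each term of
     [X] is then chosen smaller than the previous one. *)
  have hC' d : exists x, 0 < d ->
      0 < Rabs (sg x) < d /\ (Z.abs (nm x) <= Z.of_nat C)%Z.
    by have [/hC [x hx]|nd] := classic (0 < d); [exists x|exists (CubicElt 0 0 0)].
  pose G d := proj1_sig (constructive_indefinite_description _ (hC' d)).
  have hG d : 0 < d -> 0 < Rabs (sg (G d)) < d /\ (Z.abs (nm (G d)) <= Z.of_nat C)%Z :=
    proj2_sig (constructive_indefinite_description _ (hC' d)).
  pose X := fix X k := if k is k'.+1 then G (Rabs (sg (X k'))) else G 1.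
  have pos k : 0 < Rabs (sg (X k)).
    by elim: k => [|k IH] /=; [apply: (hG 1 _).1.1; lra|exact: (hG _ IH).1.1].
  exists X => k; split.
  - by move=> e; have := pos k; rewrite e Rabs_R0; lra.
  - by have := (hG _ (pos k)).1.2.
  - by case: k => [|k] /=; [apply: (hG 1 _).2; lra|exact: (hG _ (pos k)).2].
have dec (k l : nat) : (k < l)%N -> Rabs (sg (X l)) < Rabs (sg (X k)).
  elim: l => // l IH; rewrite ltnS leq_eqVlt => /orP [/eqP ->|/IH h].
    by case: (hX l).
  by case: (hX l) => _ h' _; lra.
have nz k : nm (X k) <> 0%Z.
  by case: (hX k) => s0 _ _; exact: (cubic_norm_neq0 _ _ _ _ _ _ _ hr w0 hfree s0).
(* The modulus is at most [C], so no residue is truncated by [inord]. *)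
pose res z k : 'I_C.+1 := inord (Z.to_nat (z mod Z.abs (nm (X k)))).
have hres z k : nat_of_ord (res z k) = Z.to_nat (z mod Z.abs (nm (X k))).
  rewrite /res inordK //; case: (hX k) => _ _; have := nz k.
  have := Z.mod_pos_bound z (Z.abs (nm (X k))); lia.
pose T : finType := ('I_(C + C).+1 * ('I_C.+1 * ('I_C.+1 * 'I_C.+1)))%type.
(* The norm lies between [-C] and [C], hence the shift by [C]. There is one index more than there
   are keys. *)
pose key (k : 'I_(#|T|.+1)) : T :=
  (inord (Z.to_nat (nm (X k) + Z.of_nat C)),
    (res (co0 (X k)) k, (res (co1 (X k)) k, res (co2 (X k)) k))).
have /injectivePn [k [l kl]] : ~~ injectiveb key.
  by apply/negP => /injectiveP /leq_card; rewrite card_ord ltnn.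
wlog ltkl : k l kl / (k < l)%N.
  move=> H; have [/H|] := ltnP k l; first exact.
  rewrite leq_eqVlt => /orP [/eqP /val_inj e|lk]; first by rewrite e eqxx in kl.
  by move/esym; apply: H; rewrite 1?eq_sym.
case=> /(congr1 val) en /(congr1 val) e0 /(congr1 val) e1 /(congr1 val) e2.
(* Each residue is taken modulo the norm of its own element, so the norms must be identified before
   the residues can be compared. *)
have {}en : nm (X k) = nm (X l).
  case: (hX k) => _ _ bk; case: (hX l) => _ _ bl.
  move: en bk bl; rewrite /=; move: (nm (X k)) (nm (X l)) => p q en bk bl.
  by move: en; rewrite !inordK; lia.
have cong a b : res a k = res b l :> nat -> (nm (X l) | a - b)%Z.
  rewrite !hres en => h; apply/Z.divide_abs_l; apply/Z.mod_divide; first by have := nz l; lia.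
  apply/Z.cong_iff_0.
  have p : (0 < Z.abs (nm (X l)))%Z by have := nz l; lia.
  have := Z.mod_pos_bound a _ p; have := Z.mod_pos_bound b _ p; lia.
case: (hX l) => sl0 _ _.
have [e he] := congruent_quotient_integral _ _ _ _ _ _ _ _ hr w0 hfree sl0
  (cong _ _ e0) (cong _ _ e1) (cong _ _ e2).
have ne : nm e = 1%Z.
  have := cubic_norm_mul _ _ _ _ _ _ e (X l) hr; rewrite he -/nm en.
  by have := nz l; nia.
exists e; split=> //.
(* The norm 1 is [sg e] times a sum of two squares, so [sg e] is positive. Its absolute value
   exceeds 1 because the sizes of the [X k] decrease. *)
have := IZR_cubic_norm _ _ _ _ _ _ e hr; rewrite -/nm ne -/sg.
set q := (_ + _) => hq; have q0 : 0 <= q by rewrite /q; nra.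
have hs : sg (X k) = sg e * sg (X l) by rewrite -he; exact: (real_emb_mul _ _ _ _ _ _ _ _ hr).
have := dec _ _ ltkl; rewrite hs Rabs_mult => hlt.
have sl := Rabs_pos_lt _ sl0.
have : 1 < Rabs (sg e) by apply: (Rmult_lt_reg_r (Rabs (sg (X l)))) => //; lra.
by rewrite Rabs_pos_eq //; nra.
Qed.

(** * Powers of the unit and the denominators they produce *)

Lemma polar_coordinates (x y k : R) :
  0 < k -> x * x + y * y = k * k -> exists theta, x = k * cos theta /\ y = k * sin theta.
Proof.
move=> k0 h.
have hx : -1 <= x / k <= 1.
  by split; apply: (Rmult_le_reg_r k) => //; rewrite /Rdiv Rmult_assoc Rinv_l; nra.
have hc := cos_acos _ hx; have hs := sin_acos _ hx.
have {}hs : k * sin (acos (x / k)) = Rabs y.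
  rewrite hs -sqrt_Rsqr_abs -{1}(sqrt_Rsqr k); last lra.
  rewrite -sqrt_mult; [|exact: Rle_0_sqr|rewrite /Rsqr; nra].
  congr sqrt; rewrite /Rsqr (_ : y * y = k * k - x * x); last lra.
  by field; lra.
have {}hc : k * cos (acos (x / k)) = x by rewrite hc; field; lra.
case: (Rle_lt_dec 0 y) => hy.
- by exists (acos (x / k)); rewrite hc hs Rabs_pos_eq.
- exists (- acos (x / k)); rewrite cos_neg sin_neg hc; split=> //.
  by rewrite Ropp_mult_distr_r_reverse hs Rabs_left //; ring.
Qed.

Definition cubic_pow (t u v : Z) (e : cubic_elt) (n : nat) : cubic_elt :=
  iter n (cubic_mul t u v e) (CubicElt 1 0 0).

Lemma real_emb_pow (t u v : Z) (beta r w : R) (e : cubic_elt) (n : nat) :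
  cubic_roots t u v beta r w ->
  real_emb beta (cubic_pow t u v e n) = real_emb beta e ^ n.
Proof.
move=> hr; elim: n => [|n IH]; first by rewrite /real_emb /=; ring.
by rewrite /cubic_pow iterS (real_emb_mul _ _ _ _ _ _ _ _ hr) -/(cubic_pow t u v e n) IH.
Qed.

(** De Moivre's formula in Z[beta]. *)
Lemma cplx_emb_pow (t u v : Z) (beta r w k theta : R) (e : cubic_elt) (n : nat) :
  cubic_roots t u v beta r w ->
  cplx_emb_re r w e = k * cos theta -> cplx_emb_im r w e = k * sin theta ->
  cplx_emb_re r w (cubic_pow t u v e n) = k ^ n * cos (INR n * theta) /\
  cplx_emb_im r w (cubic_pow t u v e n) = k ^ n * sin (INR n * theta).
Proof.
move=> hr h1 h2; elim: n => [|n [IH1 IH2]].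
  have -> : INR 0 * theta = 0 by rewrite /=; ring.
  by rewrite cos_0 sin_0 /cplx_emb_re /cplx_emb_im /=; split; ring.
rewrite /cubic_pow iterS (cplx_emb_re_mul _ _ _ _ _ _ _ _ hr) (cplx_emb_im_mul _ _ _ _ _ _ _ _ hr).
rewrite -/(cubic_pow t u v e n) IH1 IH2 h1 h2 S_INR.
have -> : (INR n + 1) * theta = theta + INR n * theta by ring.
by rewrite cos_plus sin_plus /=; split; ring.
Qed.

(** The trace formula for [x / f'(beta)]: the factor on the left is [f'(beta)], and the parenthesis
    on the right collects the two complex conjugate terms. *)
Lemma co2_from_embeddings (beta r w : R) (x : cubic_elt) : w <> 0 ->
  IZR (co2 x) * ((beta - r) * (beta - r) + w * w) =
    real_emb beta x - (cplx_emb_re r w x + (beta - r) / w * cplx_emb_im r w x).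
Proof. by case: x => a b c w0; rewrite /real_emb /cplx_emb_re /cplx_emb_im /=; field. Qed.

(** The integer subtracted is the beta^2-coordinate of [x beta]. By the trace formula the real
    embedding cancels in the difference, leaving only complex terms. *)
Lemma co2_beta_approx (t u v : Z) (beta r w : R) (x : cubic_elt) :
  cubic_roots t u v beta r w -> w <> 0 ->
  IZR (co2 x) * beta - IZR (co1 x + t * co2 x) = - (cplx_emb_im r w x / w).
Proof.
case: x => a b c [ht _ _] w0; rewrite /cplx_emb_im /= plus_IZR mult_IZR ht; by field.
Qed.

(** The same cancellation, with the beta^2-coordinate of [x beta^2]. *)
Lemma co2_beta2_approx (t u v : Z) (beta r w : R) (x : cubic_elt) :
  cubic_roots t u v beta r w -> w <> 0 ->
  IZR (co2 x) * (beta * beta) - IZR (co0 x + co2 x * u + t * (co1 x + t * co2 x)) =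
    - (((r + beta) * cplx_emb_im r w x + w * cplx_emb_re r w x) / w).
Proof.
case: x => a b c [ht hu _] w0; rewrite /cplx_emb_im /cplx_emb_re /= !(plus_IZR, mult_IZR) ht hu.
by field.
Qed.

Lemma le_div (a b c : R) : 0 < c -> a * c <= b -> a <= b / c.
Proof.
move=> c0 h; apply: (Rmult_le_reg_r c) => //.
by rewrite /Rdiv Rmult_assoc Rinv_l; lra.
Qed.

Lemma good_denominators (t u v q : Z) (beta r w : R) :
  cubic_roots t u v beta r w -> 0 < w -> Zfree_powers beta -> q <> 0%Z ->
  let alpha := beta / IZR q in
  exists M : R, 0 < M /\ forall B : nat, exists s : nat, (B <= s)%N /\
    [/\ (2 <= s)%N, dist_nint (INR s * alpha) <= M / sqrt (INR s),
        dist_nint (INR s * (alpha * alpha)) <= M / sqrt (INR s) &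
        dist_nint (INR s * alpha) <= M / (sqrt (INR s) * ln (INR s))].
Proof.
move=> hr w0 hfree q0 alpha.
have wn0 : w <> 0 by lra.
have qn0 : IZR q <> 0 by apply: not_0_IZR.
have [e [ne se]] := exists_nontrivial_unit _ _ _ _ _ _ hr wn0 hfree.
pose E := real_emb beta e; have E1 : 1 < E by [].
(* The modulus of the complex embedding of [e], because the norm of [e] is 1. *)
pose k := sqrt (/ E).
have kk : k * k = / E by apply: sqrt_sqrt; apply: Rlt_le; apply: Rinv_0_lt_compat; lra.
have k0 : 0 < k by apply: sqrt_lt_R0; apply: Rinv_0_lt_compat; lra.
have [theta [hre him]] : exists theta,
    cplx_emb_re r w e = k * cos theta /\ cplx_emb_im r w e = k * sin theta.
  apply: polar_coordinates => //; rewrite kk.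
  have := IZR_cubic_norm _ _ _ _ _ _ e hr; rewrite ne -/E => h.
  by apply: (Rmult_eq_reg_l E); [rewrite -h Rinv_r; lra|lra].
pose D := (beta - r) * (beta - r) + w * w.
have D0 : 0 < D.
  by have := Rmult_lt_0_compat _ _ w0 w0; have := Rle_0_sqr (beta - r); rewrite /D /Rsqr; lra.
pose A := 1 + Rabs ((beta - r) / w).
have A0 : 0 < A by have := Rabs_pos ((beta - r) / w); rewrite /A; lra.
pose Q := IZR q * IZR q.
have Q1 : 1 <= Q by rewrite /Q -mult_IZR; apply: IZR_le; nia.
(* Chosen so that [s <= G E^n]: [c D <= E^n + A <= (1 + A) E^n] and [s = Q c]. The summand 1 makes
   [ln G] positive; then [ln s <= n L] because [n >= 1]. *)
pose G := 1 + Q * (1 + A) / D.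
have G1 : 1 < G.
  have : 0 < Q * (1 + A) / D by apply: Rdiv_lt_0_compat; nra.
  by rewrite /G; lra.
pose L := ln G + ln E.
have lnG : 0 < ln G by rewrite -ln_1; apply: ln_increasing; lra.
have lnE : 0 < ln E by rewrite -ln_1; apply: ln_increasing; lra.
(* [W1] and [W2] are the constants in front of the errors for [s alpha] and [s alpha^2]. *)
pose W1 := Rabs (IZR q) / w.
pose W2 := (Rabs (r + beta) + w) / w.
have aq0 := Rabs_pos_lt _ qn0.
have W10 : 0 < W1 by exact: Rdiv_lt_0_compat.
have W20 : 0 < W2 by apply: Rdiv_lt_0_compat => //; have := Rabs_pos (r + beta); lra.
have sG : 0 < sqrt G by apply: sqrt_lt_R0; lra.
have P0 := PI_RGT_0.
have L0 : 0 < L by rewrite /L; lra.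
have W1L : 0 < W1 * PI * L by apply: Rmult_lt_0_compat => //; exact: Rmult_lt_0_compat.
exists (sqrt G * (W1 + W2 + W1 * PI * L)); split; first by apply: Rmult_lt_0_compat; lra.
move=> B.
(* From this threshold on, [c D >= E^n - A] gives [c >= B + 2]; the 2 ensures [s >= 2], hence
   [ln s > 0]. *)
have [|N hN] := Pow_x_infinity E _ (A + D * INR (B.+2)); first by rewrite Rabs_pos_eq; lra.
have [n [n0 nN hn]] := small_sin_infinite theta N.
have n1 : 1 <= INR n by apply: (le_INR 1); lia.
pose x := cubic_pow t u v e n; pose h := k ^ n.
have [hX hY] : cplx_emb_re r w x = h * cos (INR n * theta) /\
    cplx_emb_im r w x = h * sin (INR n * theta).
  exact: (cplx_emb_pow _ _ _ _ _ _ _ _ _ _ hr hre him).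
have hS : real_emb beta x = E ^ n by exact: (real_emb_pow _ _ _ _ _ _ _ _ hr).
have h0 : 0 < h by exact: pow_lt.
have En1 : 1 <= E ^ n by apply: pow_R1_Rle; lra.
have hh : h * h * E ^ n = 1.
  rewrite /h -!Rpow_mult_distr kk Rinv_l; last lra.
  exact: pow1.
have h1 : h <= 1 by nra.
have hEn : A + D * INR (B.+2) <= E ^ n.
  have := hN n; rewrite Rabs_pos_eq; last lra.
  by move=> H; apply: Rge_le; apply: H; lia.
have absX : Rabs (cplx_emb_re r w x) <= h.
  rewrite hX Rabs_mult (Rabs_pos_eq h); last lra.
  have : Rabs (cos (INR n * theta)) <= 1 by apply: Rabs_le; exact: COS_bound.
  by nra.
have absY : Rabs (cplx_emb_im r w x) <= h.
  rewrite hY Rabs_mult (Rabs_pos_eq h); last lra.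
  have : Rabs (sin (INR n * theta)) <= 1 by apply: Rabs_le; exact: SIN_bound.
  by nra.
have absY' : Rabs (cplx_emb_im r w x) * INR n <= h * PI.
  rewrite hY Rabs_mult (Rabs_pos_eq h); last lra.
  rewrite Rmult_assoc; apply: Rmult_le_compat_l; first lra.
  apply: (Rle_trans _ (PI / INR n * INR n)); first by apply: Rmult_le_compat_r; lra.
  by apply: Req_le; field; lra.
pose c := IZR (co2 x).
have hc : Rabs (c * D - E ^ n) <= A.
  rewrite /c /D (co2_from_embeddings _ _ _ _ wn0) hS.
  rewrite (_ : _ - _ = - (cplx_emb_re r w x + (beta - r) / w * cplx_emb_im r w x)); last ring.
  rewrite Rabs_Ropp; apply: Rle_trans (Rabs_triang _ _) _; rewrite Rabs_mult /A.
  have := Rabs_pos ((beta - r) / w); have := Rabs_pos (cplx_emb_im r w x); nra.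
have [hc1 hc2] : - A <= c * D - E ^ n <= A by split; move: hc; rewrite /Rabs; case: Rcase_abs; lra.
have cB : INR B.+2 <= c by apply: (Rmult_le_reg_r D) => //; lra.
have cZ : (Z.of_nat B.+2 <= co2 x)%Z by apply: le_IZR; rewrite -INR_IZR_INZ.
(* The factor [q^2] clears the denominators: [s alpha = q c beta] and [s alpha^2 = c beta^2]. *)
pose s := Z.to_nat (q * q * co2 x).
have sE : INR s = Q * c by rewrite /s INR_IZR_INZ Z2Nat.id ?mult_IZR //; nia.
have qq : (1 <= q * q)%Z by nia.
have qc : (co2 x <= q * q * co2 x)%Z.
  by move: cZ qq; move: (q * q)%Z (co2 x) => p p' ? ?; nia.
have sB : (B.+2 <= s)%N by rewrite /s; move: cZ qc; move: (q * q * co2 x)%Z (co2 x) => p p'; lia.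
exists s; split; first lia.
have s2 : 2 <= INR s by apply: (le_INR 2); lia.
have sG' : INR s <= G * E ^ n.
  have Hc : c <= (1 + A) * E ^ n / D by apply: le_div => //; nra.
  have Q0 : 0 <= Q by lra.
  have H := Rmult_le_compat_l Q _ _ Q0 Hc.
  have e1 : Q * ((1 + A) * E ^ n / D) = (G - 1) * E ^ n by rewrite /G; field; lra.
  by rewrite sE; lra.
(* Since [h^2 E^n = 1], the bound [s <= G E^n] reads [s h^2 <= G]. *)
have ss : sqrt (INR s) * h <= sqrt G.
  rewrite -{1}(sqrt_square h); last lra.
  rewrite -sqrt_mult; [|lra|nra].
  by apply: sqrt_le_1_alt; nra.
have s0 : 0 < sqrt (INR s) by apply: sqrt_lt_R0; lra.
have ls0 : 0 < ln (INR s) by rewrite -ln_1; apply: ln_increasing; lra.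
have ls : ln (INR s) <= INR n * L.
  apply: (Rle_trans _ (ln (G * E ^ n))).
    by case: sG' => [sG'|->]; [apply: Rlt_le; apply: ln_increasing; lra|lra].
  rewrite ln_mult; [|lra|lra]; rewrite ln_pow; [|lra]; rewrite /L; nra.
have d1 : dist_nint (INR s * alpha) <= W1 * Rabs (cplx_emb_im r w x).
  apply: Rle_trans (dist_nint_le _ (q * (co1 x + t * co2 x))) _.
  have -> : INR s * alpha - IZR (q * (co1 x + t * co2 x)) = IZR q * (- (cplx_emb_im r w x / w)).
    rewrite mult_IZR -(co2_beta_approx _ _ _ _ _ _ x hr wn0) sE /alpha /Q /c; field; lra.
  rewrite Rabs_mult Rabs_Ropp /Rdiv Rabs_mult (Rabs_pos_eq (/ w)); last first.
    by apply: Rlt_le; exact: Rinv_0_lt_compat.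
  by apply: Req_le; rewrite /W1; field.
have d2 : dist_nint (INR s * (alpha * alpha)) <= W2 * h.
  apply: Rle_trans (dist_nint_le _ (co0 x + co2 x * u + t * (co1 x + t * co2 x))) _.
  have -> : INR s * (alpha * alpha) = IZR (co2 x) * (beta * beta).
    by rewrite sE /alpha /Q /c; field.
  rewrite (co2_beta2_approx _ _ _ _ _ _ x hr wn0) Rabs_Ropp /Rdiv Rabs_mult.
  rewrite (Rabs_pos_eq (/ w)); last by apply: Rlt_le; exact: Rinv_0_lt_compat.
  rewrite (_ : W2 * h = (Rabs (r + beta) + w) * h * / w); last by rewrite /W2; field.
  apply: Rmult_le_compat_r; first by apply: Rlt_le; exact: Rinv_0_lt_compat.
  apply: Rle_trans (Rabs_triang _ _) _; rewrite !Rabs_mult (Rabs_pos_eq w); last lra.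
  have := Rabs_pos (r + beta); nra.
have order_half X W : 0 < W -> W <= W1 + W2 + W1 * PI * L -> X <= W * h ->
    X <= sqrt G * (W1 + W2 + W1 * PI * L) / sqrt (INR s).
  move=> Wp Wle hX'; apply: le_div => //.
  apply: (Rle_trans _ (W * h * sqrt (INR s))); first by apply: Rmult_le_compat_r; lra.
  rewrite Rmult_assoc (Rmult_comm h) Rmult_comm.
  by apply: Rmult_le_compat; try lra; apply: Rmult_le_pos; lra.
split; first lia.
- apply: (order_half _ W1); [lra|lra|apply: Rle_trans d1 _; apply: Rmult_le_compat_l; lra].
- by apply: (order_half _ W2); lra.
(* The factor [ln s <= n L] is absorbed by the [1 / n] gained in [absY'], and [sqrt s] by [h]. *)
- apply: le_div; first exact: Rmult_lt_0_compat.
  have Y0 := Rabs_pos (cplx_emb_im r w x).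
  apply: (Rle_trans _ (W1 * Rabs (cplx_emb_im r w x) * (sqrt (INR s) * (INR n * L)))).
    apply: Rmult_le_compat => //.
    - by rewrite /dist_nint; have := Int_part_bounds (INR s * alpha) => hb; apply: Rmin_glb; lra.
    - by apply: Rmult_le_pos; lra.
    - by apply: Rmult_le_compat_l; lra.
  rewrite (_ : _ * _ = W1 * sqrt (INR s) * L * (Rabs (cplx_emb_im r w x) * INR n)); last ring.
  apply: (Rle_trans _ (W1 * sqrt (INR s) * L * (h * PI))).
    by apply: Rmult_le_compat_l => //; apply: Rmult_le_pos; [apply: Rmult_le_pos|]; lra.
  rewrite (_ : _ * _ = W1 * PI * L * (sqrt (INR s) * h)); last ring.
  apply: (Rle_trans _ (W1 * PI * L * sqrt G)); first by apply: Rmult_le_compat_l; lra.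
  by rewrite Rmult_comm; apply: Rmult_le_compat_l; lra.
Qed.

(** * Reduction from an integral cubic to a monic one *)

Lemma complex_roots_of_unique_real_root (t u v : Z) (beta : R) :
  Zfree_powers beta ->
  (forall y, y * y * y = IZR t * (y * y) + IZR u * y + IZR v <-> y = beta) ->
  exists r w : R, 0 < w /\ cubic_roots t u v beta r w.
Proof.
move=> hfree hroot.
have hbeta := (hroot beta).2 erefl.
pose r := (IZR t - beta) / 2.
pose d := beta * beta - IZR t * beta - IZR u - r * r.
(* The cubic factors as [(y - beta) ((y - r)^2 + d)]. If [d <= 0], the quadratic factor has real
   roots, all equal to [beta]; then [3 beta = t], against linear independence. *)
have [d0|d0] := Rle_lt_dec d 0.
  have sq : sqrt (- d) * sqrt (- d) = - d by apply: sqrt_sqrt; lra.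
  have root y : (y - r) * (y - r) = - d -> y = beta.
    move=> hy; apply/hroot.
    have : (y - beta) * ((y - r) * (y - r) + d) = 0 by rewrite hy; ring.
    by rewrite /d /r; lra.
  move: (sqrt (- d)) sq => S sq.
  have e1 : r + S = beta by apply: root; rewrite -sq; ring.
  have e2 : r - S = beta by apply: root; rewrite -sq; ring.
  have [|_ //] := hfree (- t)%Z 3%Z 0%Z.
  by rewrite opp_IZR; rewrite /r in e1 e2; lra.
exists r, (sqrt d); split; first exact: sqrt_lt_R0.
have sq : sqrt d * sqrt d = d by apply: sqrt_sqrt; lra.
by split; rewrite ?sq /d /r; lra.
Qed.

Lemma Peck_sequence_integer_cubic (a b c d : Z) (alpha : R) :
  a <> 0%Z -> Zfree_powers alpha ->
  (forall x, IZR a * (x * x * x) + IZR b * (x * x) + IZR c * x + IZR d = 0 <-> x = alpha) ->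
  exists s : nat -> nat, Peck_sequence alpha (alpha * alpha) s.
Proof.
move=> a0 hfree hroot.
have A0 : IZR a <> 0 by apply: not_0_IZR.
(* Multiplying the equation of [alpha] by [a^2] gives a monic integral equation for [a alpha]. *)
pose beta := IZR a * alpha.
have bfree : Zfree_powers beta.
  move=> x y z e; have [|h0 h1 h2] := hfree x (y * a)%Z (z * (a * a))%Z.
    by rewrite !mult_IZR -e /beta; ring.
  by split=> //; nia.
have broot y : y * y * y = IZR (- b) * (y * y) + IZR (- (a * c)) * y + IZR (- (a * a * d)) <->
    y = beta.
  rewrite !opp_IZR !mult_IZR; split=> [hy|->].
  - suff -> : y = IZR a * (y / IZR a)
      by congr (_ * _); apply/hroot;
        apply: (Rmult_eq_reg_l (IZR a * IZR a)); [field_simplify; lra|nra].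
    by field.
  - have := (hroot alpha).2 erefl => h; rewrite /beta.
    have -> : IZR d =
        - (IZR a * (alpha * alpha * alpha) + IZR b * (alpha * alpha) + IZR c * alpha) by lra.
    by ring.
have [r [w [w0 hr]]] := complex_roots_of_unique_real_root _ _ _ _ bfree broot.
have [M [M0 hM]] := good_denominators _ _ _ a _ _ _ hr w0 bfree a0.
have ea : beta / IZR a = alpha by rewrite /beta; field.
rewrite ea in hM.
have [s [hs hP]] := strictly_increasing_choice _ hM.
exists s; split=> [n|]; first by case: (hP n); lia.
(* Passing from [M] to [M + 1] makes the inequalities strict. *)
split=> //; exists (M + 1), (M + 1); do 2 (split; first lra).
exists (fun n => n); split=> //; split=> [n|]; first by case: (hP n).
split=> n; case: (hP n) => s2 d1 d2 d3.
- have S2 : 2 <= INR (s n) by apply: (le_INR 2); lia.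
  have S0 : 0 < sqrt (INR (s n)) by apply: sqrt_lt_R0; lra.
  have : M / sqrt (INR (s n)) < (M + 1) / sqrt (INR (s n)).
    by apply: Rmult_lt_compat_r; [exact: Rinv_0_lt_compat|lra].
  by move=> lt; apply: Rmax_lub_lt; lra.
- have S2 : 2 <= INR (s n) by apply: (le_INR 2); lia.
  have S0 : 0 < sqrt (INR (s n)) by apply: sqrt_lt_R0; lra.
  have L0 : 0 < ln (INR (s n)) by rewrite -ln_1; apply: ln_increasing; lra.
  apply: Rle_lt_trans d3 _; apply: Rmult_lt_compat_r; last lra.
  by apply: Rinv_0_lt_compat; exact: Rmult_lt_0_compat.
Qed.

(** * From irreducible rational polynomials to integral coefficients and linear independence *)

Lemma int_to_R_IZR (z : int) : exists k : Z, int_to_R z = IZR k.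
Proof.
case: z => n.
- by exists (Z.of_nat n); rewrite /= INR_IZR_INZ.
- by exists (- Z.of_nat n.+1)%Z; rewrite /int_to_R opp_IZR INR_IZR_INZ.
Qed.

Local Close Scope R_scope.
Import GRing.Theory Num.Theory.
Local Open Scope ring_scope.

Lemma int_to_R_intr (z : int) : int_to_R z = z%:~R.
Proof.
case: z => n /=; first by rewrite INRE.
by rewrite NegzE mulrNz -[n.+1%:~R]/(n.+1%:R) -INRE.
Qed.

Lemma rat_to_R_ratr (q : rat) : rat_to_R q = ratr q.
Proof. by rewrite /rat_to_R !int_to_R_intr RdivE. Qed.

Lemma rat_to_R_fraction (q : rat) :
  exists k l : Z, [/\ rat_to_R q = (IZR k / IZR l)%R, l <> 0%Z & k = 0%Z -> q = 0].
Proof.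
have [k hk] := int_to_R_IZR (numq q); have [l hl] := int_to_R_IZR (denq q).
have inj (z : int) : int_to_R z = 0 -> z = 0.
  by rewrite int_to_R_intr => /eqP; rewrite intr_eq0 => /eqP.
exists k, l; split; first by rewrite /rat_to_R hk hl.
- by move=> l0; rewrite l0 in hl; have /eqP := inj _ hl; rewrite denq_eq0.
- by move=> k0; rewrite k0 in hk; have /eqP := inj _ hk; rewrite numq_eq0 => /eqP.
Qed.

Lemma peval_R_common_denominator (p : {poly rat}) : size p = 4%N ->
  exists (a b c d : Z) (l : R), [/\ l <> 0%R, a <> 0%Z & forall x : R,
    (IZR a * (x * x * x) + IZR b * (x * x) + IZR c * x + IZR d)%R = (l * peval_R p x)%R].
Proof.
case: p => s hs; rewrite /peval_R /=; case: s hs => [|q0 [|q1 [|q2 [|q3 [|]]]]] //= q3n0 _.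
have [k0 [l0 [-> nl0 _]]] := rat_to_R_fraction q0.
have [k1 [l1 [-> nl1 _]]] := rat_to_R_fraction q1.
have [k2 [l2 [-> nl2 _]]] := rat_to_R_fraction q2.
have [k3 [l3 [-> nl3 nk3]]] := rat_to_R_fraction q3.
exists (k3 * l0 * l1 * l2)%Z, (k2 * l0 * l1 * l3)%Z, (k1 * l0 * l2 * l3)%Z, (k0 * l1 * l2 * l3)%Z.
exists (IZR (l0 * l1 * l2 * l3)); split.
- by apply: not_0_IZR; nia.
- have nk : k3 <> 0%Z by move/nk3 => e; rewrite e eqxx in q3n0.
  by nia.
- move=> x; rewrite !mult_IZR.
  have := not_0_IZR _ nl0; have := not_0_IZR _ nl1.
  have := not_0_IZR _ nl2; have := not_0_IZR _ nl3.
  by move=> ? ? ? ?; field; do !split.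
Qed.

Lemma peval_R_horner (p : {poly rat}) (x : R) : peval_R p x = (map_poly ratr p).[x].
Proof.
rewrite map_polyE horner_Poly /peval_R.
by elim: (polyseq p) => //= q s ->; rewrite rat_to_R_ratr RplusE RmultE mulrC addrC.
Qed.

(** A nonzero [g] of smaller degree would be coprime to the irreducible [p]; evaluating a Bezout
    relation at the common root [x] would make a nonzero constant vanish. *)
Lemma irreducible_root_small_degree (p g : {poly rat}) (x : R) :
  irreducible_poly p -> peval_R p x = 0 -> peval_R g x = 0 ->
  (size g < size p)%N -> g = 0.
Proof.
rewrite !peval_R_horner => [[sp irr]] hp hg sg; apply/eqP/negPn/negP => g0.
have cop : coprimep p g.
  apply/negPn/negP => nc; have := irr _ nc (dvdp_gcdl p g).
  rewrite eqp_sym => /andP [/(dvdp_trans)/(_ (dvdp_gcdr p g)) /(dvdp_leq g0)].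
  by rewrite leqNgt sg.
have /Bezout_coprimepP [[a b] /= /eqpP [[c d] /= /andP [c0 d0]]] := cop.
move=> /(congr1 (fun f => (map_poly (ratr : {rmorphism rat -> R}) f).[x])).
rewrite !map_polyZ rmorphD !rmorphM !hornerE /= hp hg rmorph1 hornerE.
rewrite mulr0 addr0 mulr0 hornerE mulr1 => /esym/eqP; rewrite fmorph_eq0.
by rewrite (negbTE d0).
Qed.

Lemma IZR_ratr (z : Z) : exists2 q : rat, ratr q = IZR z & (q = 0 -> z = 0%Z).
Proof.
have nn (n : nat) : ratr (n%:R : rat) = IZR (Z.of_nat n) :> R.
  by rewrite -INR_IZR_INZ INRE rmorph_nat.
have [q hq] : exists q : rat, ratr q = IZR z.
  have [n [->|->]] : exists n, z = Z.of_nat n \/ z = (- Z.of_nat n)%Z.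
    by exists (Z.abs_nat z); lia.
  - by exists n%:R; exact: nn.
  - by exists (- n%:R); rewrite opp_IZR -nn; exact: rmorphN.
exists q => // q0; apply: eq_IZR; by rewrite -hq q0 rmorph0.
Qed.

(** An integral relation between 1, [alpha] and [alpha^2] is a polynomial of degree at most 2
    vanishing at [alpha], hence zero. *)
Lemma Zfree_powers_irreducible_root (p : {poly rat}) (alpha : R) :
  size p = 4%N -> irreducible_poly p -> peval_R p alpha = 0 -> Zfree_powers alpha.
Proof.
move=> sp irr hp a b c h.
have [qa ha za] := IZR_ratr a; have [qb hb zb] := IZR_ratr b; have [qc hc zc] := IZR_ratr c.
have g0 : Poly [:: qa; qb; qc] = 0.
  apply: (irreducible_root_small_degree _ _ _ irr hp); last first.
    by rewrite sp ltnS; exact: size_Poly.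
  rewrite peval_R_horner map_Poly horner_Poly /= ha hb hc mul0r add0r.
  by rewrite -[RHS]h !RplusE !RmultE mulrDl addrC addrA -!mulrA addrAC addrC addrA.
have co i := congr1 (fun f : {poly rat} => f`_i) g0.
by split; [apply: za|apply: zb|apply: zc]; [have := co 0%N|have := co 1%N|have := co 2%N];
  rewrite coef_Poly coef0.
Qed.

Theorem theorem2 (p : {poly rat}) (alpha : R) :
  size p = 4%N ->
  irreducible_poly p ->
  peval_R p alpha = 0%R ->
  (forall x : R, peval_R p x = 0%R -> x = alpha) ->
  exists s : nat -> nat, Peck_sequence alpha (alpha * alpha)%R s.
Proof.
move=> sp irr hp huniq.
have hfree := Zfree_powers_irreducible_root _ _ sp irr hp.
have [a [b [c [d [l [l0 a0 hl]]]]]] := peval_R_common_denominator _ sp.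
apply: (Peck_sequence_integer_cubic a b c d _ a0 hfree) => x; rewrite hl; split.
- by case/Rmult_integral => // /huniq.
- by move=> ->; rewrite hp Rmult_0_r.
Qed.
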